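(* Let $\kappa$ be a field and let $\Lambda$ be the preprojective algebra over $\kappa$ of the quiver with vertices $1,\dots,6$ and arrows $1\to4$, $2\to4$, $4\to3$, $4\to5$, $5\to6$. Let $B$ be the $\Lambda$-module with $B_1=\langle a_1,a_2,a_3\rangle$, $B_2=\langle b_1,b_2,b_3\rangle$, $B_3=\langle c_1,c_2\rangle$, $B_4=\langle e_1,e_2,e_3,e_4\rangle$, $B_5=\langle f_1,f_2\rangle$, $B_6=\langle g\rangle$ (the listed vectors forming $\kappa$-bases), and with structure maps $$\begin{array}{ll} B_4\to B_1: & e_1\mapsto a_1,\ e_2\mapsto a_2,\ e_3\mapsto a_3,\ e_4\mapsto 0;\\ B_1\to B_4: & a_1\mapsto 0,\ a_2\mapsto e_4,\ a_3\mapsto e_4;\\ B_4\to B_2: & e_1\mapsto b_2,\ e_2,e_3,e_4\mapsto 0;\\ B_2\to B_4: & b_1\mapsto e_2,\ b_2\mapsto e_3,\ b_3\mapsto e_4;\\ B_4\to B_3: & e_1\mapsto c_1,\ e_2\mapsto c_2,\ e_3,e_4\mapsto 0;\\ B_3\to B_4: & c_1\mapsto e_3,\ c_2\mapsto e_4;\\ B_4\to B_5: & e_1,e_2\mapsto 0,\ e_3\mapsto f_1,\ e_4\mapsto f_2;\\ B_5\to B_4: & f_1\mapsto e_4,\ f_2\mapsto 0;\\ B_5\to B_6: & f_1\mapsto g,\ f_2\mapsto 0;\\ B_6\to B_5: & g\mapsto f_2. \end{array}$$ Then $B$ is a real brick, but is not a shard module.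
   Context: Let $Q$ be the quiver with arrows $1\to4$, $2\to4$, $4\to3$, $4\to5$, $5\to6$, and for each arrow $a:i\to j$ of $Q$ adjoin a reverse arrow $a^*:j\to i$; put $(a^* )^*=a$, $\mathrm{sgn}(a)=1$ for $a\in Q$ and $\mathrm{sgn}(a^* )=-1$. The preprojective algebra $\Lambda$ is the quotient of the path algebra of the doubled quiver over $\kappa$ by the relations, one for each vertex $i$, $\sum_{a\text{ with source }i}\mathrm{sgn}(a)\,a^*a=0$ (paths composed right to left). A $\Lambda$-module is a collection of vector spaces $M_1,\dots,M_6$ and linear maps for each arrow of the doubled quiver satisfying these relations. The associated Cartan matrix $A$ is symmetric $6\times 6$ with $A_{ii}=2$, $A_{ij}=-1$ if $i,j$ are joined by an arrow of $Q$ and $A_{ij}=0$ otherwise. $V=\mathbb R^6$ has basis $\alpha_1,\dots,\alpha_6$ with $(\alpha_i,\alpha_j)=A_{ij}$ and reflections $s_i(x)=x-(\alpha_i,x)\alpha_i$; $W$ is the group generated by the $s_i$, and the real roots are the vectors $w\alpha_i$, $w\in W$. The dimension vector of a finite dimensional module is $\dim M=\sum_i(\dim_\kappa M_i)\alpha_i$. A brick is a nonzero finite dimensional $\Lambda$-module whose endomorphism ring is a division ring; a real brick is a brick whose dimension vector is a real root. For $\theta\in V^*$, $M$ is $\theta$-semistable if $\langle\theta,\dim M\rangle=0$ and $\langle\theta,\dim K\rangle\ge 0$ for every submodule $K\subseteq M$; $\mathrm{Stab}(M)\subseteq V^*$ is the polyhedral cone of all $\theta$ for which $M$ is $\theta$-semistable.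 A shard module is a real brick $B$ such that $\mathrm{Stab}(B)$ has dimension $n-1$, where $n$ is the number of vertices (here $n-1=5$). *)

(* Defs.v *)
From HB Require Import structures.
From mathcomp Require Import all_boot all_order all_algebra.
From mathcomp Require Import reals.

Set Implicit Arguments.
Unset Strict Implicit.
Unset Printing Implicit Defensive.

Import Order.TTheory GRing.Theory Num.Theory.
Local Open Scope ring_scope.

(* A finite quiver: [mult i j] is the number of arrows [i -> j]. *)
Record quiver := Quiver {
  nv : nat;
  mult : 'I_nv -> 'I_nv -> nat
}.

Section DoubledQuiver.
Variable Q : quiver.
Implicit Types i j : 'I_(nv Q).

(* Arrows [i -> j] of the doubled quiver: [inl a] is an arrow [a : i -> j] of
   [Q], and [inr a] is the reverse [a^*] of an arrow [a : j -> i] of [Q]. *)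
Definition darrow i j : finType := ('I_(mult i j) + 'I_(mult j i))%type.

Definition star i j (a : darrow i j) : darrow j i :=
  match a with inl b => inr b | inr b => inl b end.

Definition sgn (K : fieldType) i j (a : darrow i j) : K :=
  if a is inl _ then 1 else -1.

End DoubledQuiver.

(* Finite dimensional modules over the preprojective algebra of [Q] over [K]. *)
Record ppmodule (K : fieldType) (Q : quiver) := PPModule {
  space : 'I_(nv Q) -> vectType K;
  act : forall i j, darrow i j -> 'Hom(space i, space j);
  act_preprojective : forall i,
    \sum_j \sum_(a : darrow i j) sgn K a *: (act (star a) \o act a)%VF = 0
}.

Section Bricks.
Variables (K : fieldType) (Q : quiver).
Implicit Type M : ppmodule K Q.

Definition is_submodule M (N : forall i, {vspace space M i}) : Prop :=
  forall i j (a : darrow i j), (act M a @: N i <= N j)%VS.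

Definition is_endo M (f : forall i, 'End(space M i)) : Prop :=
  forall i j (a : darrow i j), (f j \o act M a)%VF = (act M a \o f i)%VF.

Definition nonzero_module M : Prop := exists i, (\dim {: space M i} != 0)%N.

(* For [M] nonzero, so that [1 != 0] in its endomorphism ring. *)
Definition endo_division M : Prop :=
  forall f, @is_endo M f -> (exists i, f i != 0) ->
  exists g, [/\ @is_endo M g, forall i, (g i \o f i)%VF = \1%VF
                            & forall i, (f i \o g i)%VF = \1%VF].

Definition brick M : Prop := nonzero_module M /\ endo_division M.

End Bricks.

Section Roots.
Variables (R : realType) (Q : quiver).
Local Notation V := 'rV[R]_(nv Q).
Implicit Types (i j : 'I_(nv Q)) (x y : V).

Definition alpha i : V := delta_mx 0 i.

(* For a quiver without loops. *)
Definition cartan : 'M[R]_(nv Q) :=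
  \matrix_(i, j) if i == j then 2%:R else - (mult i j + mult j i)%:R.

Definition form x y : R := (x *m cartan *m y^T) 0 0.

Definition refl i x : V := x - form (alpha i) x *: alpha i.

(* The group of bijections of [V] generated by the reflections. *)
Inductive weyl : (V -> V) -> Prop :=
| weyl_gen i : weyl (refl i)
| weyl_id : weyl id
| weyl_comp w w' : weyl w -> weyl w' -> weyl (w \o w')
| weyl_inv w w' : weyl w -> cancel w w' -> cancel w' w -> weyl w'.

Definition real_root x : Prop := exists w i, weyl w /\ x = w (alpha i).

End Roots.

Section Shards.
Variables (R : realType) (K : fieldType) (Q : quiver).
Local Notation V := 'rV[R]_(nv Q).
Local Notation Vdual := 'Hom(V, R^o).
Implicit Type M : ppmodule K Q.

Definition dimv_sub M (N : forall i, {vspace space M i}) : V :=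
  \sum_i (\dim (N i))%:R *: alpha R i.

Definition dimv M : V := dimv_sub (fun i => {: space M i}%VS).

Definition stab M (theta : Vdual) : Prop :=
  theta (dimv M) = 0 /\
  forall N, @is_submodule _ _ M N -> 0 <= (theta (dimv_sub N) : R).

(* A cone contains 0, so its affine hull is its linear span. *)
Definition is_span (C : Vdual -> Prop) (U : {vspace Vdual}) : Prop :=
  (forall t, C t -> t \in U) /\
  (forall U' : {vspace Vdual}, (forall t, C t -> t \in U') -> (U <= U')%VS).

Definition cone_dim (C : Vdual -> Prop) (m : nat) : Prop :=
  exists2 U, is_span C U & \dim U = m.

Definition real_brick M : Prop := brick M /\ real_root (dimv M).

Definition shard_module M : Prop :=
  real_brick M /\ cone_dim (stab M) (nv Q).-1.

End Shards.

(* In the tables below vertices and basis vectors are numbered from 1, so the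
   vertex [i] is the ordinal of value [i - 1]. *)

Definition Q6_arrows : seq (nat * nat) :=
  [:: (1, 4); (2, 4); (4, 3); (4, 5); (5, 6)]%N.

Definition Q6 : quiver :=
  @Quiver 6 (fun i j => (i.+1, j.+1) \in Q6_arrows : nat).

Definition B_dim (i : 'I_6) : nat := nth 0 [:: 3; 3; 2; 4; 2; 1]%N i.

(* [(i, j, p, q)] is listed when [B_i -> B_j] sends the [p]-th basis vector of
   [B_i] to the [q]-th basis vector of [B_j]; all other basis vectors of [B_i]
   are sent to 0. *)
Definition B_table : seq (nat * nat * nat * nat) :=
  [:: (4, 1, 1, 1); (4, 1, 2, 2); (4, 1, 3, 3);
      (1, 4, 2, 4); (1, 4, 3, 4);
      (4, 2, 1, 2);
      (2, 4, 1, 2); (2, 4, 2, 3); (2, 4, 3, 4);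
      (4, 3, 1, 1); (4, 3, 2, 2);
      (3, 4, 1, 3); (3, 4, 2, 4);
      (4, 5, 3, 1); (4, 5, 4, 2);
      (5, 4, 1, 4);
      (5, 6, 1, 1);
      (6, 5, 1, 2)]%N.

Definition B_entry (i j p q : nat) : bool :=
  (i.+1, j.+1, p.+1, q.+1) \in B_table.

Section ModuleB.
Variable K : fieldType.

(* Row [p] is the image of the [p]-th basis vector: matrices act on row vectors
   on the right. *)
Definition B_mx (i j : 'I_6) : 'M[K]_(B_dim i, B_dim j) :=
  \matrix_(p, q) (B_entry i j p q)%:R.

Definition B_space (i : 'I_6) : vectType K := 'rV[K]_(B_dim i).

Definition B_act (i j : 'I_(nv Q6)) (a : darrow i j) :
    'Hom(B_space i, B_space j) :=
  linfun (mulmxr (B_mx i j)).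

Definition B_rel_coef (i p q : nat) : int :=
  foldr (fun j s =>
    (((i.+1, j.+1) \in Q6_arrows)%:Z - ((j.+1, i.+1) \in Q6_arrows)%:Z) *
    foldr (fun k t => (B_entry i j p k)%:Z * (B_entry j i k q)%:Z + t) 0
      (iota 0 (nth 0 [:: 3; 3; 2; 4; 2; 1]%N j)) + s) 0 (iota 0 6).

Lemma B_rel_coef0 (i p q : nat) :
  (i < 6)%N -> (p < 4)%N -> (q < 4)%N -> B_rel_coef i p q = 0.
Proof.
have: all (fun i => all (fun p => all (fun q => B_rel_coef i p q == 0)
        (iota 0 4)) (iota 0 4)) (iota 0 6) by vm_compute.
move=> /allP all6 i6 p4 q4.
have /all6/allP all4 : i \in iota 0 6 by rewrite mem_iota.
have /all4/allP all4' : p \in iota 0 4 by rewrite mem_iota.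
by apply/eqP/all4'; rewrite mem_iota.
Qed.

Lemma foldr_sum (V : zmodType) n (F : nat -> V) :
  foldr (fun j s => F j + s) 0 (iota 0 n) = \sum_(j < n) F j.
Proof. by rewrite -(big_mkord xpredT) /index_iota subn0 unlock. Qed.

Lemma B_dim_le4 i : (B_dim i <= 4)%N.
Proof. by case: i => [[|[|[|[|[|[|m]]]]]]]. Qed.

Lemma B_act_preprojective (i : 'I_(nv Q6)) :
  \sum_j \sum_(a : darrow i j) sgn K a *: (B_act (star a) \o B_act a)%VF = 0.
Proof.
pose L (i j : 'I_6) : 'Hom(B_space i, B_space j) := linfun (mulmxr (B_mx i j)).
pose m (j k : nat) : nat := (j.+1, k.+1) \in Q6_arrows.
transitivity (\sum_(j < 6) ((m i j)%:R *: (L j i \o L i j)%VF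
                               - (m j i)%:R *: (L j i \o L i j)%VF)).
  apply: eq_bigr => j _; rewrite big_sumType /B_act /= !big_const_ord !iter_addr_0.
  by rewrite scale1r scaleN1r mulNrn !scaler_nat.
apply/lfunP => v; rewrite sum_lfunE zero_lfunE.
transitivity (v *m \sum_(j < 6) ((m i j)%:R - (m j i)%:R)
                      *: (B_mx i j *m B_mx j i)).
  rewrite mulmx_sumr; apply: eq_bigr => j _.
  rewrite -scalerBl scale_lfunE comp_lfunE !lfunE /=.
  by rewrite -scalemxAr mulmxA.
suff -> : \sum_(j < 6) ((m i j)%:R - (m j i)%:R) *: (B_mx i j *m B_mx j i) = 0.
  by rewrite mulmx0.
apply/matrixP => p q; rewrite summxE mxE.
have lt4 (r : 'I_(B_dim i)) : (r < 4)%N.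
  exact: leq_trans (ltn_ord r) (B_dim_le4 i).
rewrite -[RHS](rmorph0 (intr : int -> K)).
rewrite -(B_rel_coef0 (ltn_ord i) (lt4 p) (lt4 q)) /B_rel_coef.
rewrite (@foldr_sum _ _ (fun j => _ * _)) rmorph_sum.
apply: eq_bigr => j _; rewrite !mxE (@foldr_sum _ _ (fun k => _ * _)).
rewrite rmorphM rmorphB rmorph_sum; congr (_ * _).
by apply: eq_bigr => k _; rewrite !mxE rmorphM.
Qed.

Definition B_module : ppmodule K Q6 := PPModule B_act_preprojective.

End ModuleB.

(* Main.v *)
Require Import Defs.
From HB Require Import structures.
From mathcomp Require Import all_boot all_order all_algebra.
From mathcomp Require Import reals.

Set Implicit Arguments.
Unset Strict Implicit.
Unset Printing Implicit Defensive.

Import Order.TTheory GRing.Theory Num.Theory.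
Local Open Scope ring_scope.

(** Write [a_p], [b_p], [c_p], [e_p], [f_p], [g] for the basis vectors at the
vertices 1 to 6; every arrow sends a basis vector to a basis vector or to 0.

_Brick._  For an endomorphism [f], comparing the two sides of
[f (a v) = a (f v)] for an arrow [a] and a basis vector [v] gives linear
relations between the coefficients of the images of basis vectors; most of them
say that two coefficients are equal or that one is 0
([endo_coef_eq], [endo_coef0_img], [endo_coef0_pre]).  They force
[f e_1 = c e_1] for some [c] ([scaled_by_e1]), hence [f v = c v] for all basis
vectors reached from [e_1], in particular for [e_4].  The vectors [b_1] and
[b_3], which generate the rest, are treated through the injective map from
[B_2] to [B_4].  The scalar of [b_1] agrees with [c] because [b_1] is sent to
[e_4] by way of [e_2] and [a_2].  So the endomorphism ring is the field itself
([endo_scalar]).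

_Real root._  Reflecting (3, 3, 2, 4, 2, 1) so as to lower its height leads to
the simple root [alpha_6] ([real_root_B]).

_Not a shard module._  The coordinate subspaces
[<a_1, a_2, b_1, c_2, e_2, e_4, f_2>] and
[<a_2, b_1, b_3, c_2, e_2, e_4, f_2, g>] are submodules, and their dimension
vectors add up to that of [B] ([dimv_labels12]).  A [theta] in [Stab(B)] is
nonnegative on both and zero on their sum, hence zero on both.  As the first of
them is not proportional to [dim B], the cone [Stab(B)] lies in the intersection
of two distinct hyperplanes, of dimension 4 ([stab_codim2]). *)

(** * Coordinate subspaces of row vectors *)

Section BasisVectors.
Variables (K : fieldType) (n : nat).
Implicit Types (p q : nat) (v : 'rV[K]_n).

(** Basis vectors are numbered from 1, in agreement with the table of [B]. *)
Definition bvec p : 'rV[K]_n := \row_(r < n) (r.+1 == p)%:R.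

Definition coef q v : K := \sum_(r < n | r.+1 == q) v 0 r.

Lemma iota1P q : q \in iota 1 n -> exists r : 'I_n, q = r.+1.
Proof.
by rewrite mem_iota add1n ltnS; case: q => // q lt_qn; exists (Ordinal lt_qn).
Qed.

Lemma mem_iota1 (r : 'I_n) : r.+1 \in iota 1 n.
Proof. by rewrite mem_iota /= add1n ltnS. Qed.

Lemma coefS (r : 'I_n) v : coef r.+1 v = v 0 r.
Proof. by rewrite /coef (big_pred1 r). Qed.

Lemma coef_sum q (I : Type) (s : seq I) (P : pred I) (F : I -> 'rV[K]_n) :
  coef q (\sum_(i <- s | P i) F i) = \sum_(i <- s | P i) coef q (F i).
Proof.
rewrite /coef exchange_big /=; apply: eq_bigr => r _.
by rewrite summxE.
Qed.

Lemma sum_iota1 (U : nmodType) (P : pred nat) (F : nat -> U) :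
  \sum_(k <- [seq k <- iota 1 n | P k]) F k = \sum_(r < n | P r.+1) F r.+1.
Proof.
rewrite big_filter -[1%N]/(1 + 0)%N iotaDl big_map.
by rewrite -(subn0 n) -/(index_iota 0 n) big_mkord subn0.
Qed.

Lemma bvecS (r : 'I_n) : bvec r.+1 = delta_mx 0 r.
Proof. by apply/rowP => s; rewrite !mxE eqSS. Qed.

Lemma sum_coef v : v = \sum_(q <- iota 1 n) coef q v *: bvec q.
Proof.
rewrite -[iota 1 n]filter_predT sum_iota1 [LHS]row_sum_delta.
by apply: eq_bigr => r _; rewrite coefS bvecS.
Qed.

Lemma free_bvec (s : seq nat) :
  uniq s -> {subset s <= iota 1 n} -> free [seq bvec p | p <- s].
Proof.
elim: s => [|p s IHs] /=; first by rewrite nil_free.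
case/andP=> ps us sub_s; rewrite free_cons IHs ?andbT //; last first.
  by move=> q qs; apply: sub_s; rewrite inE qs orbT.
have /sub_s/iota1P[r Dp] : p \in p :: s by rewrite inE eqxx.
rewrite {p}Dp in ps {sub_s} *.
(* The entry of index r is 0 on the span, but 1 at [bvec r.+1]. *)
apply/negP => /(@coord_span _ _ _ (in_tuple _)).
move=> /(congr1 (fun v : 'rV_n => v 0 r)) /eqP.
rewrite summxE mxE eqxx big1 ?oner_eq0 // => i _.
rewrite mxE; set x := _`_i.
have /mapP[q qs ->] : x \in [seq bvec p | p <- s].
  by rewrite mem_nth ?size_tuple.
rewrite mxE /=; case: eqP => [eq_q|_]; last by rewrite mulr0.
by rewrite eq_q qs in ps.
Qed.

End BasisVectors.

(** * The arrows of B on basis vectors *)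

Local Notation v1 := (@Ordinal 6 0 isT).
Local Notation v2 := (@Ordinal 6 1 isT).
Local Notation v3 := (@Ordinal 6 2 isT).
Local Notation v4 := (@Ordinal 6 3 isT).
Local Notation v5 := (@Ordinal 6 4 isT).
Local Notation v6 := (@Ordinal 6 5 isT).

Definition B_img (i j : 'I_6) p : seq nat :=
  [seq q <- iota 1 (B_dim j) | (i.+1, j.+1, p, q) \in B_table].

Definition B_pre (i j : 'I_6) q : seq nat :=
  [seq p <- iota 1 (B_dim i) | (i.+1, j.+1, p, q) \in B_table].

Section Arrows.
Variable K : fieldType.
Implicit Types i j : 'I_6.

Notation "''e_' i p" := (bvec K (B_dim i) p)
  (at level 8, i at level 2, p at level 8).

Lemma bvec_B_mx i j p : p \in iota 1 (B_dim i) ->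
  'e_i p *m B_mx K i j = \sum_(q <- B_img i j p) 'e_j q.
Proof.
case/iota1P=> r ->; rewrite sum_iota1 bvecS -rowE.
rewrite [LHS]row_sum_delta [RHS]big_mkcond.
apply: eq_bigr => s _; rewrite !mxE bvecS /B_entry /=.
by case: ifP => _; rewrite ?scale1r ?scale0r.
Qed.

Lemma coef_B_mx i j q (v : 'rV_(B_dim i)) : q \in iota 1 (B_dim j) ->
  coef q (v *m B_mx K i j) = \sum_(p <- B_pre i j q) coef p v.
Proof.
case/iota1P=> s ->; rewrite sum_iota1 coefS mxE [RHS]big_mkcond.
apply: eq_bigr => r _; rewrite coefS mxE /B_entry /=.
by case: ifP => _; rewrite ?mulr1 ?mulr0.
Qed.

Lemma B_mx_act i j (v : 'rV_(B_dim i)) (a : @darrow Q6 i j) :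
  act (B_module K) a v = v *m B_mx K i j.
Proof. by rewrite lfunE. Qed.

(** An endomorphism is only required to commute with the arrows; this makes it
commute with the matrices [B_mx i j] for all pairs of vertices. *)
Lemma B_mx_disconnected i j : (@darrow Q6 i j -> False) -> B_mx K i j = 0.
Proof.
move=> no_a; apply/matrixP => p q; rewrite !mxE /B_entry.
case: (boolP (_ \in _)) => // tab.
have con : ((i.+1, j.+1) \in Q6_arrows) || ((j.+1, i.+1) \in Q6_arrows).
  move: tab; move: (i.+1) (j.+1) (p.+1) (q.+1) => a b c d.
  have /allP con : all (fun t : nat * nat * nat * nat =>
     (t.1.1 \in Q6_arrows) || ((t.1.1.2, t.1.1.1) \in Q6_arrows)) B_table by [].
  by move/con.
case: no_a; case: (boolP (_ \in _)) con => [c _|nc /= c].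
  by left; rewrite /= c; exact: ord0.
by right; rewrite /= c; exact: ord0.
Qed.

Lemma endo_B_mx (f : forall i, 'End(Defs.space (B_module K) i)) :
  is_endo (M := B_module K) f -> forall i j (v : 'rV_(B_dim i)),
  f j (v *m B_mx K i j : 'rV_(B_dim j)) = f i v *m B_mx K i j :> 'rV_(B_dim j).
Proof.
move=> endo_f i j v.
have [a _|no_a] := pickP (@predT (@darrow Q6 i j)); last first.
  rewrite B_mx_disconnected; last by move=> a; have := no_a a.
  by rewrite !mulmx0 linear0.
have /lfunP/(_ v) := endo_f i j a.
by rewrite !comp_lfunE !B_mx_act.
Qed.

(** * The endomorphisms of B *)

Section Endomorphism.
Variable f : forall i, 'End(Defs.space (B_module K) i).
Hypothesis endo_f : is_endo (M := B_module K) f.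

Definition endo_coef i p q : K := coef q (f i ('e_i p) : 'rV_(B_dim i)).
Local Notation x := endo_coef.

(** Both sides are the coefficient at [q] of the image of ['e_i p] under the
arrow and [f], taken in the two orders. *)
Lemma endo_coef_arrow i j p q :
  p \in iota 1 (B_dim i) -> q \in iota 1 (B_dim j) ->
  \sum_(k <- B_img i j p) x j k q = \sum_(l <- B_pre i j q) x i p l.
Proof.
move=> ip jq; rewrite /endo_coef -coef_B_mx // -endo_B_mx //.
by rewrite bvec_B_mx // linear_sum coef_sum.
Qed.

Lemma endo_coef_eq i j p q k l :
  [&& p \in iota 1 (B_dim i), q \in iota 1 (B_dim j),
      B_img i j p == [:: k] & B_pre i j q == [:: l]] ->
  x j k q = x i p l.
Proof.
case/and4P=> ip jq /eqP img_p /eqP pre_q.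
by have := endo_coef_arrow ip jq; rewrite img_p pre_q !big_seq1.
Qed.

Lemma endo_coef0_img i j p q l :
  [&& p \in iota 1 (B_dim i), q \in iota 1 (B_dim j),
      B_img i j p == [::] & B_pre i j q == [:: l]] ->
  x i p l = 0.
Proof.
case/and4P=> ip jq /eqP img_p /eqP pre_q.
by have := endo_coef_arrow ip jq; rewrite img_p pre_q big_seq1 big_nil.
Qed.

Lemma endo_coef0_pre i j p q k :
  [&& p \in iota 1 (B_dim i), q \in iota 1 (B_dim j),
      B_img i j p == [:: k] & B_pre i j q == [::]] ->
  x j k q = 0.
Proof.
case/and4P=> ip jq /eqP img_p /eqP pre_q.
by have := endo_coef_arrow ip jq; rewrite img_p pre_q big_seq1 big_nil.
Qed.

Definition scaled_by c i p := f i ('e_i p) = c *: 'e_i p :> 'rV_(B_dim i).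

Lemma scaled_byP c i p :
  scaled_by c i p <->
  (forall q, q \in iota 1 (B_dim i) -> x i p q = if q == p then c else 0).
Proof.
split=> [scal_p q /iota1P[r ->] | xp].
  rewrite /endo_coef scal_p coefS !mxE.
  by case: (_ == p); rewrite ?mulr1 ?mulr0.
apply/rowP => r; rewrite -coefS [LHS]xp ?mem_iota1 // !mxE.
by case: (_ == p); rewrite ?mulr1 ?mulr0.
Qed.

(** The vectors scaled by [c] form a submodule: this spreads the scalar from
generators to all of [B]. *)
Lemma scaled_by_arrow c i p j q :
  (p \in iota 1 (B_dim i)) && (B_img i j p == [:: q]) ->
  scaled_by c i p -> scaled_by c j q.
Proof.
case/andP=> ip /eqP img_p scal_p; have := endo_B_mx endo_f j ('e_i p).
by rewrite scal_p -scalemxAl bvec_B_mx // img_p !big_seq1.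
Qed.

(** The coefficients at [e_3] and [e_4] vanish since [e_1] is killed on the way
to [B_5], where [e_3] and [e_4] survive.  As for [e_2], the two paths from [e_1]
to [e_3], through [b_2] and through [c_1], must act alike on [f e_1]; the path
through [B_3] sends [e_2] to [e_4], the one through [B_2] kills it. *)
Lemma scaled_by_e1 : scaled_by (x v4 1 1) v4 1.
Proof.
apply/scaled_byP => -[|[|[|[|[|q]]]]] //= _.
- rewrite -(@endo_coef_eq v4 v3 1 2 1 2) //.
  rewrite -(@endo_coef_eq v3 v4 1 4 3 2) //.
  rewrite (@endo_coef_eq v2 v4 2 4 3 3) //.
  exact: (@endo_coef0_pre v4 v2 1 3 2).
- exact: (@endo_coef0_img v4 v5 1 1 3).
- exact: (@endo_coef0_img v4 v5 1 2 4).
Qed.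

Lemma endo_scalar : exists c, forall i, f i = c *: \1%VF.
Proof.
pose c := x v4 1 1; exists c.
(* The basis vectors reached from e_1. *)
have e1 : scaled_by c v4 1 := scaled_by_e1.
have a1 : scaled_by c v1 1 by apply: scaled_by_arrow e1.
have b2 : scaled_by c v2 2 by apply: scaled_by_arrow e1.
have c1 : scaled_by c v3 1 by apply: scaled_by_arrow e1.
have e3 : scaled_by c v4 3 by apply: scaled_by_arrow b2.
have a3 : scaled_by c v1 3 by apply: scaled_by_arrow e3.
have f1 : scaled_by c v5 1 by apply: scaled_by_arrow e3.
have e4 : scaled_by c v4 4 by apply: scaled_by_arrow f1.
have f2 : scaled_by c v5 2 by apply: scaled_by_arrow e4.
have g1 : scaled_by c v6 1 by apply: scaled_by_arrow f1.
have /scaled_byP x4 := e4.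
(* The map from B_2 to B_4 is injective and sends b_3 to e_4. *)
have b3 : scaled_by c v2 3.
  apply/scaled_byP => -[|[|[|[|q]]]] //= _.
  - by rewrite -(@endo_coef_eq v2 v4 3 2 4 1) // x4.
  - by rewrite -(@endo_coef_eq v2 v4 3 3 4 2) // x4.
  - by rewrite -(@endo_coef_eq v2 v4 3 4 4 3) // x4.
(* It sends b_1 to e_2, which is killed on the way to B_5. *)
have b1 : scaled_by c v2 1.
  apply/scaled_byP => -[|[|[|[|q]]]] //= _.
  - rewrite -(@endo_coef_eq v2 v4 1 2 2 1) //.
    rewrite -(@endo_coef_eq v4 v1 2 2 2 2) //.
    (* f a_2 is sent to f e_4 = c e_4 in B_4; there a_2 and a_3 have the same
       image, so the coefficient of f a_2 at a_3 has to be excluded. *)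
    have a2_a3 : x v1 2 3 = 0.
      rewrite (@endo_coef_eq v4 v1 2 3 2 3) //.
      exact: (@endo_coef0_img v4 v5 2 1 3).
    have := @endo_coef_arrow v1 v4 2 4 isT isT.
    by rewrite big_seq1 big_cons big_seq1 a2_a3 addr0 x4.
  - rewrite -(@endo_coef_eq v2 v4 1 3 2 2) //.
    exact: (@endo_coef0_img v4 v5 2 1 3).
  - rewrite -(@endo_coef_eq v2 v4 1 4 2 3) //.
    exact: (@endo_coef0_img v4 v5 2 2 4).
have e2 : scaled_by c v4 2 by apply: scaled_by_arrow b1.
have a2 : scaled_by c v1 2 by apply: scaled_by_arrow e2.
have c2 : scaled_by c v3 2 by apply: scaled_by_arrow e2.
have all_scaled i p : p \in iota 1 (B_dim i) -> scaled_by c i p.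
  case: i => [[|[|[|[|[|[|k]]]]]] ki] //; rewrite (bool_irrelevance ki isT);
  by case: p => [|[|[|[|[|p]]]]].
move=> i; apply/lfunP => v; rewrite scale_lfunE id_lfunE [v]sum_coef.
rewrite linear_sum scaler_sumr [LHS]big_seq [RHS]big_seq.
apply: eq_bigr => p ip.
by rewrite linearZ /= all_scaled // scalerA mulrC -scalerA.
Qed.

End Endomorphism.

End Arrows.

Lemma dim_B (K : fieldType) i :
  \dim {: Defs.space (B_module K) i} = B_dim i.
Proof. by rewrite dimvf dim_matrix; apply: mul1n. Qed.

Lemma brick_B (K : fieldType) : brick (B_module K).
Proof.
split=> [|f endo_f [i fi_neq0]].
  by exists v1; rewrite dim_B.
have [c Df] := endo_scalar endo_f.
have c_neq0 : c != 0.
  by apply: contraNneq fi_neq0 => c0; rewrite Df c0 scale0r.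
exists (fun j => c^-1 *: \1%VF); split=> [j k a | j | j].
- by rewrite -comp_lfunZl -comp_lfunZr comp_lfun1l comp_lfun1r.
- by rewrite Df -comp_lfunZl comp_lfun1l scalerA mulVf ?scale1r.
- by rewrite Df -comp_lfunZr comp_lfun1r scalerA mulVf ?scale1r.
Qed.

(** * The dimension vector of B *)

Lemma dimv_subE (R : realType) (K : fieldType) (Q : quiver)
    (M : ppmodule K Q) (N : forall i, {vspace Defs.space M i}) :
  dimv_sub R N = \row_i (\dim (N i))%:R.
Proof.
rewrite [RHS]row_sum_delta; apply: eq_bigr => i _.
by rewrite mxE.
Qed.

Section RealRoot.
Variable R : realType.

(** Integer sequences stand for the vectors of the root lattice, on which the
reflections can be evaluated by computation. *)
Definition int_row (s : seq int) : 'rV[R]_6 := \row_i (s`_i)%:~R.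

Definition int_cartan (i j : nat) : int :=
  if i == j then 2 else
  - (((i.+1, j.+1) \in Q6_arrows)%:Z + ((j.+1, i.+1) \in Q6_arrows)%:Z).

Definition int_refl (i : nat) (s : seq int) : seq int :=
  mkseq (fun k => s`_k -
    foldr (fun j y => int_cartan i j * s`_j + y) 0 (iota 0 6) * (k == i)%:Z) 6.

Lemma refl_int_row (i : 'I_6) s :
  @refl R Q6 i (int_row s) = int_row (int_refl i s).
Proof.
have form_i : @Defs.form R Q6 (@alpha R Q6 i) (int_row s) =
    (foldr (fun j y => int_cartan i j * s`_j + y) 0 (iota 0 6))%:~R.
  rewrite /Defs.form -rowE mxE (@foldr_sum _ _ (fun j => _ * _)) rmorph_sum.
  apply: eq_bigr => j _; rewrite !mxE rmorphM /int_cartan val_eqE.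
  by congr (_ * _); case: (i == j) => //; rewrite rmorphN natrD rmorphD.
apply/rowP => k; rewrite !mxE form_i nth_mkseq // rmorphB rmorphM.
by rewrite eqxx.
Qed.

Lemma real_root_refl (Q : quiver) i x :
  @real_root R Q x -> real_root (refl i x).
Proof.
case=> w [j [weyl_w ->]]; exists (refl i \o w), j; split=> //.
exact: weyl_comp (weyl_gen _ i) weyl_w.
Qed.

Lemma real_root_B (K : fieldType) : real_root (Defs.dimv R (B_module K)).
Proof.
(* Applied to the dimension vector from left to right, each of these reflections
   lowers the height; undoing them from alpha_6 gives the dimension vector. *)
pose l := [:: v1; v2; v4; v3; v5; v4; v1; v2; v4; v5].
pose r := foldr (fun i : 'I_6 => int_refl i) [:: 0; 0; 0; 0; 0; 1 : int] l.
suff -> : Defs.dimv R (B_module K) = int_row r.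
  rewrite /r; elim: (l) => /= [|i l' IHl].
    exists id, v6; split; first exact: weyl_id.
    apply/rowP => i; rewrite !mxE /=.
    by case: i => [[|[|[|[|[|[|k]]]]]] ki].
  by rewrite -refl_int_row; apply: real_root_refl IHl.
have -> : r = [:: 3; 3; 2; 4; 2; 1] by vm_compute.
apply/rowP => i; rewrite /Defs.dimv dimv_subE !mxE dim_B.
by case: i => [[|[|[|[|[|[|k]]]]]] ki].
Qed.

End RealRoot.

(** * Stab(B) spans a subspace of codimension at least two *)

Section CoordinateSubmodules.
Variable K : fieldType.
Variable S : seq (nat * nat).

Definition labels (i : 'I_6) := [seq p <- iota 1 (B_dim i) | (i.+1, p) \in S].

Definition label_sub (i : 'I_(nv Q6)) : {vspace Defs.space (B_module K) i} :=
  <<[seq bvec K (B_dim i) p | p <- labels i]>>%VS.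

Lemma dim_label_sub i : \dim (label_sub i) = size (labels i).
Proof.
rewrite -(size_map (bvec K (B_dim i))); apply/eqP.
apply: free_bvec => [|p]; first by rewrite filter_uniq ?iota_uniq.
by rewrite mem_filter => /andP[].
Qed.

Lemma is_submodule_label_sub :
    all (fun t : nat * nat * nat * nat =>
      ((t.1.1.1, t.1.2) \in S) ==> ((t.1.1.2, t.2) \in S)) B_table ->
  is_submodule label_sub.
Proof.
move=> /allP closed_S i j a; rewrite limg_span; apply/span_subvP => v.
case/mapP=> u /mapP[p]; rewrite mem_filter => /andP[Sp ip] -> ->.
rewrite B_mx_act bvec_B_mx // big_seq; apply: memv_suml => q.
rewrite mem_filter => /andP[pq jq]; apply/memv_span/map_f.
by rewrite mem_filter jq andbT; apply: (implyP (closed_S _ pq)).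
Qed.

End CoordinateSubmodules.

Section Annihilators.
Variables (F : fieldType) (V : vectType F).
Local Notation Vdual := 'Hom(V, F^o).

Definition eval_at (x : V) (theta : Vdual) : F^o := theta x.

Fact eval_at_linear x : linear (eval_at x).
Proof. by move=> a s t; rewrite /eval_at add_lfunE scale_lfunE. Qed.

HB.instance Definition _ x :=
  GRing.isLinear.Build F Vdual F^o _ (eval_at x) (eval_at_linear x).

Definition annihilator x : {vspace Vdual} := lker (linfun (eval_at x)).

Lemma mem_annihilator x theta : (theta \in annihilator x) = (theta x == 0).
Proof. by rewrite memv_ker lfunE. Qed.

(** Two strict inclusions: [s] lies outside the annihilator of [x], and [t]
lies in it but not in that of [y]. *)
Lemma dim_annihilator2 x y (s t : Vdual) :
  s x != 0 -> t x = 0 -> t y != 0 ->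
  (\dim (annihilator x :&: annihilator y) + 2 <= dim V)%N.
Proof.
move=> sx tx ty.
have lt_dim (U W : {vspace Vdual}) r :
    (U <= W)%VS -> r \in W -> r \notin U -> (\dim U < \dim W)%N.
  move=> sUW rW; apply: contraNltn => leWU.
  suff /eqP-> : U == W by [].
  by rewrite eqEdim sUW.
have lt_x : (\dim (annihilator x) < dim V)%N.
  have -> : dim V = \dim {:Vdual} by rewrite dimvf /dim /= muln1.
  by apply: (lt_dim _ _ s); rewrite ?subvf ?memvf ?mem_annihilator.
apply: leq_trans lt_x; rewrite addn2 ltnS.
apply: (lt_dim _ _ t); rewrite ?capvSl ?memv_cap ?mem_annihilator ?tx //.
by rewrite eqxx.
Qed.

End Annihilators.

Section Entries.
Variables (R : nzRingType) (n : nat).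

Definition entry (k : 'I_n) (v : 'rV[R]_n) : R^o := v 0 k.

Fact entry_linear k : linear (entry k).
Proof. by move=> a v w; rewrite /entry !mxE. Qed.

HB.instance Definition _ k :=
  GRing.isLinear.Build R 'rV[R]_n R^o _ (entry k) (entry_linear k).

End Entries.

(** The pair [(i, p)] denotes the basis vector [p] at the vertex [i].  Both
lists contain the basis of the submodule generated by [b_1]; the first one adds
[a_1], which is sent to 0, and the second one adds [b_3] and [g], which are sent
into that submodule. *)
Definition labels1 : seq (nat * nat) :=
  [:: (1, 1); (1, 2); (2, 1); (3, 2); (4, 2); (4, 4); (5, 2)]%N.

Definition labels2 : seq (nat * nat) :=
  [:: (1, 2); (2, 1); (2, 3); (3, 2); (4, 2); (4, 4); (5, 2); (6, 1)]%N.

Lemma dimv_labels12 (R : realType) (K : fieldType) :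
  dimv_sub R (label_sub K labels1) + dimv_sub R (label_sub K labels2)
  = Defs.dimv R (B_module K).
Proof.
rewrite /Defs.dimv !dimv_subE; apply/rowP => i.
rewrite !mxE !dim_label_sub dim_B -natrD; congr (_%:R).
by case: i => [[|[|[|[|[|[|k]]]]]] ki].
Qed.

(** Two nonnegative values adding up to [theta (dim B) = 0] vanish. *)
Lemma stab_labels1 (R : realType) (K : fieldType)
    (theta : 'Hom('rV[R]_(nv Q6), R^o)) :
  stab (B_module K) theta -> theta (dimv_sub R (label_sub K labels1)) = 0.
Proof.
case=> theta_B theta_sub.
have ge1 := theta_sub _ (is_submodule_label_sub K (S := labels1) isT).
have ge2 := theta_sub _ (is_submodule_label_sub K (S := labels2) isT).
apply: le_anti; rewrite ge1 andbT.
move: theta_B; rewrite -dimv_labels12 linearD => /eqP; rewrite addr_eq0.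
by move/eqP->; rewrite oppr_le0.
Qed.

Lemma stab_codim2 (R : realType) (K : fieldType) m :
  cone_dim (stab (R := R) (B_module K)) m -> (m + 2 <= 6)%N.
Proof.
case=> U [_ U_min] <-.
pose V := 'rV[R]_(nv Q6).
pose x : V := Defs.dimv R (B_module K).
pose y : V := dimv_sub R (label_sub K labels1).
have <- : dim V = 6%N by rewrite dim_matrix; apply: mul1n.
have entryE k (v : V) : linfun (entry k) v = v 0 k by rewrite lfunE.
apply: leq_trans (@dim_annihilator2 _ V y x (linfun (entry v1))
  (linfun (entry v6)) _ _ _); last 3 first.
(* Here y = (2, 1, 1, 2, 1, 0) and x = (3, 3, 2, 4, 2, 1), which the first and
   the last entry tell apart. *)
- by rewrite entryE /y dimv_subE mxE dim_label_sub pnatr_eq0.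
- by rewrite entryE /y dimv_subE mxE dim_label_sub.
- by rewrite entryE /x /Defs.dimv dimv_subE mxE dim_B pnatr_eq0.
rewrite leq_add2r; apply/dimvS/U_min => theta stab_theta.
rewrite memv_cap !mem_annihilator (stab_labels1 stab_theta) eqxx.
by case: stab_theta => ->; rewrite eqxx.
Qed.

Theorem theorem7p2 (R : realType) (K : fieldType) :
  real_brick R (B_module K) /\ ~ shard_module R (B_module K).
Proof.
split; first by split; [apply: brick_B | apply: real_root_B].
by case=> _ /stab_codim2.
Qed.
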